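(* Let $\mathcal{S}(\mathbf{c})=\{\mathbf{c}(\tau)+t(0,1,0):\tau\in I,\ t\in\mathbb{R}\}$ be a cylindrical support surface symmetric about the $yz$-plane. Let $$\Sigma=\{(r\sin s,\,t,\,m+r\cos s): -s_0\le s\le s_0,\ t\in\mathbb{R}\},\qquad r>0,\ m\in\mathbb{R},\ 0<s_0<\pi,$$ be a section of a circular cylinder of radius $r$ which is a capillary surface on $\mathcal{S}(\mathbf{c})$ with contact angle $\gamma\in(0,\pi)$, meeting $\mathcal{S}(\mathbf{c})$ exactly along the two lines $L_{s_0}^{\pm}=\{s=\pm s_0\}$, which pass through the points $\mathbf{c}(\pm\tau_0)$. Let $\mu(\tau_0)=r\kappa(\tau_0)+\delta\cos\gamma$, where $\kappa(\tau_0)$ is the (signed) curvature of $\mathbf{c}$ at the contact points and $\delta=\pm1$ is determined by $A(\nu,\nu)=\delta/r$. Suppose $\sin\gamma-s_0\mu(\tau_0)\neq0$ and $\mu(\tau_0)\neq 0$. Let $\Sigma_h=\{0\le t\le h\}\subset\Sigma$ be a rectangular piece of $\Sigma$ of length $h$. If $h>h_0$, then $\Sigma_h$ is unstable, where $h_0$ is given as follows. 1. Case $\mu(\tau_0)>0$: $h_0=\dfrac{2\pi r}{\sqrt{1+\beta_1^2}}$, where $\beta_1$ is the (unique) solution in $\left(\frac{\mu(\tau_0)}{\sin\gamma},\infty\right)$ of $$e^{4\beta s_0}=\left(\frac{\beta\sin\gamma+\mu(\tau_0)}{\beta\sin\gamma-\mu(\tau_0)}\right)^2 .$$ 2. Case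 $\mu(\tau_0)<0$: if $\beta_{1,1}<1$, then $h_0=\dfrac{2\pi r}{\sqrt{1-\beta_{1,1}^2}}$, where $\beta_{1,1}$ is the unique solution in $\left(0,\frac{\pi}{2s_0}\right)$ of $\tan(\beta s_0)=-\dfrac{\mu(\tau_0)}{\beta\sin\gamma}$.
   Context: Setting. $\mathbf{c}(\tau)=(x(\tau),0,z(\tau))$, $\tau\in I$, is a smooth regular embedded curve in the $xz$-plane, $I$ is an interval symmetric about $0$, and $\mathbf{c}(-\tau)=(-x(\tau),0,z(\tau))$. The surface $\mathcal{S}(\mathbf{c})$ separates $\mathbb{R}^3$ into two domains. A capillary surface $\Sigma$ on $\mathcal{S}(\mathbf{c})$ is a surface of constant mean curvature lying in one of these domains, with $\partial\Sigma\subset\mathcal{S}(\mathbf{c})$, which together with a region of $\mathcal{S}(\mathbf{c})$ bounds a domain $\Omega$ (the fluid), and which makes a constant angle $\gamma$ with $\mathcal{S}(\mathbf{c})$ along $\partial\Sigma$. Here $\cos\gamma=\langle N,\widetilde N\rangle$, where $N$ is the unit normal of $\Sigma$ pointing into $\Omega$ and $\widetilde N$ is the unit normal of $\mathcal{S}(\mathbf{c})$ pointing out of $\Omega$. Curvature signs. $\kappa$ denotes the curvature of $\mathbf{c}$ computed with respect to the unit normal $-\widetilde N$ (so $\kappa=\langle \mathbf{c}'',-\widetilde N\rangle$ if $\mathbf{c}$ is parametrized by arc length). By symmetry $\kappa(-\tau_0)=\kappa(\tau_0)$. $A$ is the second fundamental form of $\Sigma$ with respect to $N$, and $\nu$ is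 the exterior unit conormal of $\partial\Sigma$ in $\Sigma$. One has $A(\nu,\nu)=1/r$ ($\delta=1$) when $N$ points towards the axis of the cylinder (the fluid is on the side of the axis), and $A(\nu,\nu)=-1/r$ ($\delta=-1$) when $N$ points away from the axis. Stability of the piece $\Sigma_h$. Put $$Q[u]=\int_{\Sigma_h}\left(|\nabla u|^2-|A|^2u^2\right)d\Sigma-\int_{\{s=\pm s_0\}}\mathbf{q}\,u^2\,dt,\qquad |A|^2=\frac1{r^2},\quad \mathbf{q}=\frac{\kappa(\tau_0)}{\sin\gamma}+\cot\gamma\,A(\nu,\nu)=\frac{\mu(\tau_0)}{r\sin\gamma}.$$ $\Sigma_h$ is unstable if there is $u\in C^\infty(\Sigma_h)$ vanishing on the sides $t=0$ and $t=h$ (and free on the sides $s=\pm s_0$), with $\int_{\Sigma_h}u\,d\Sigma=0$ and $Q[u]<0$. *)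

(* Defs.v *)
From Stdlib Require Export Reals.
From Coquelicot Require Export Coquelicot.
Open Scope R_scope.

Notation R3 := (R * R * R)%type.

Definition dot (v w : R3) : R :=
  let '(a, b, c) := v in let '(a', b', c') := w in a * a' + b * b' + c * c'.

Definition cross (v w : R3) : R3 :=
  let '(a, b, c) := v in let '(a', b', c') := w in
  (b * c' - c * b', c * a' - a * c', a * b' - b * a').

Definition vnorm (v : R3) : R := sqrt (dot v v).

Definition subset (A B : R3 -> Prop) : Prop := forall p, A p -> B p.

Definition boundary (A : R3 -> Prop) (p : R3) : Prop :=
  forall V : R3 -> Prop, locally p V ->
    (exists q, V q /\ A q) /\ (exists q, V q /\ ~ A q).

Definition connected (A : R3 -> Prop) : Prop :=
  ~ exists U V : R3 -> Prop,
      open U /\ open V /\ (forall p, A p -> U p \/ V p) /\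
      (forall p, A p -> ~ (U p /\ V p)) /\
      (exists p, A p /\ U p) /\ (exists p, A p /\ V p).

Definition is_domain (A : R3 -> Prop) : Prop :=
  (exists p, A p) /\ open A /\ connected A.

Definition separates (S D D' : R3 -> Prop) : Prop :=
  is_domain D /\ is_domain D' /\
  (forall p, ~ (D p /\ D' p)) /\
  (forall p, ~ S p <-> D p \/ D' p).

(* A region of a surface S may be disconnected or unbounded; it is only asked
   to be non-empty and contained in the closure of its interior relative to S. *)
Definition rel_interior (S W : R3 -> Prop) (p : R3) : Prop :=
  W p /\ locally p (fun q => S q -> W q).

Definition is_region (S W : R3 -> Prop) : Prop :=
  (exists p, W p) /\ subset W S /\
  forall p, W p -> forall V : R3 -> Prop, locally p V ->
    exists q, V q /\ rel_interior S W q.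

Definition points_into (Om : R3 -> Prop) (p v : R3) : Prop :=
  exists e0, 0 < e0 /\ forall e, 0 < e < e0 ->
    Om (plus p (scal e v)) /\ ~ Om (minus p (scal e v)).

Definition pd1 (X : R -> R -> R3) (s t : R) : R3 :=
  (Derive (fun a => fst (fst (X a t))) s,
   Derive (fun a => snd (fst (X a t))) s,
   Derive (fun a => snd (X a t)) s).

Definition pd2 (X : R -> R -> R3) (s t : R) : R3 :=
  (Derive (fun b => fst (fst (X s b))) t,
   Derive (fun b => snd (fst (X s b))) t,
   Derive (fun b => snd (X s b)) t).

(* Coefficients of the first fundamental form. *)
Definition ffE X s t : R := dot (pd1 X s t) (pd1 X s t).
Definition ffF X s t : R := dot (pd1 X s t) (pd2 X s t).
Definition ffG X s t : R := dot (pd2 X s t) (pd2 X s t).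
Definition ffW X s t : R := ffE X s t * ffG X s t - ffF X s t ^ 2.

Definition area_density X s t : R := sqrt (ffW X s t).

(* A unit normal field of a parametrized surface is +-(X_s x X_t)/|X_s x X_t|;
   the sign is the parameter eps. *)
Definition is_sign (eps : R) : Prop := eps = 1 \/ eps = -1.

Definition unit_normal (eps : R) (X : R -> R -> R3) (s t : R) : R3 :=
  let w := cross (pd1 X s t) (pd2 X s t) in scal (eps / vnorm w) w.

(* Second fundamental form A(v,w) = <D_v w, N> for N = unit_normal eps X;
   [sff] takes tangent vectors given by their coordinates in the frame (X_s, X_t). *)
Definition sfL eps X s t : R := dot (pd1 (pd1 X) s t) (unit_normal eps X s t).
Definition sfM eps X s t : R := dot (pd2 (pd1 X) s t) (unit_normal eps X s t).
Definition sfN eps X s t : R := dot (pd2 (pd2 X) s t) (unit_normal eps X s t).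

Definition sff eps X s t (v w : R * R) : R :=
  sfL eps X s t * (fst v * fst w)
  + sfM eps X s t * (fst v * snd w + snd v * fst w)
  + sfN eps X s t * (snd v * snd w).

Definition mean_curvature eps X s t : R :=
  (sfL eps X s t * ffG X s t - 2 * sfM eps X s t * ffF X s t
   + sfN eps X s t * ffE X s t) / (2 * ffW X s t).

Definition gauss_curvature eps X s t : R :=
  (sfL eps X s t * sfN eps X s t - sfM eps X s t ^ 2) / ffW X s t.

(* |A|^2 = k1^2 + k2^2 = (k1 + k2)^2 - 2 k1 k2. *)
Definition sff_norm2 eps X s t : R :=
  (2 * mean_curvature eps X s t) ^ 2 - 2 * gauss_curvature eps X s t.

Definition grad_norm2 (X : R -> R -> R3) (u : R -> R -> R) (s t : R) : R :=
  let us := Derive (fun a => u a t) s in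
  let ut := Derive (fun b => u s b) t in
  (ffG X s t * us ^ 2 - 2 * ffF X s t * us * ut + ffE X s t * ut ^ 2) / ffW X s t.

(* Coordinates, in the frame (X_s, X_t), of the unit tangent vector orthogonal
   to X_t whose X_s-component has the sign of sg. It is the exterior conormal
   along s = s0 for sg = 1, and along s = -s0 for sg = -1, of a surface
   parametrized over -s0 <= s <= s0. *)
Definition conormal (sg : R) (X : R -> R -> R3) (s t : R) : R * R :=
  (sg * sqrt (ffG X s t / ffW X s t),
   - sg * (ffF X s t / ffG X s t) * sqrt (ffG X s t / ffW X s t)).

Definition is_interval (I : R -> Prop) : Prop :=
  forall a b c, I a -> I b -> a <= c <= b -> I c.

Definition curve (x z : R -> R) (tau : R) : R3 := (x tau, 0, z tau).

(* A function is smooth on a set when it is smooth in a neighbourhood of every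
   point of the set; for one on a closed set this is the existence of a smooth
   extension, the values outside being irrelevant. *)
Definition smooth1 (f : R -> R) (I : R -> Prop) : Prop :=
  forall tau, I tau -> locally tau (fun a => forall n, ex_derive_n f n a).

Definition smooth2 (f : R -> R -> R) (P : R -> R -> Prop) : Prop :=
  forall s t, P s t -> locally_2d (fun a b => forall n, ex_diff_n f n a b) s t.

Definition regular_curve (x z : R -> R) (I : R -> Prop) : Prop :=
  forall tau, I tau -> Derive x tau <> 0 \/ Derive z tau <> 0.

(* Injective, with continuous inverse c(I) -> I. *)
Definition embedded_curve (x z : R -> R) (I : R -> Prop) : Prop :=
  (forall a b, I a -> I b -> curve x z a = curve x z b -> a = b) /\
  (forall tau, I tau -> forall U : R -> Prop, locally tau U ->
     locally (curve x z tau) (fun p => forall a, I a -> curve x z a = p -> U a)).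

Definition symmetric_curve (x z : R -> R) (I : R -> Prop) : Prop :=
  forall tau, I tau -> I (- tau) /\ x (- tau) = - x tau /\ z (- tau) = z tau.

Definition support_param (x z : R -> R) (tau t : R) : R3 := (x tau, t, z tau).

Definition support (x z : R -> R) (I : R -> Prop) (p : R3) : Prop :=
  exists tau t, I tau /\ p = support_param x z tau t.

(* Curvature of c with respect to the unit normal -Ñ, Ñ being the unit normal
   of the support surface of sign eps; c need not have unit speed. *)
Definition kappa (eps : R) (x z : R -> R) (tau : R) : R :=
  dot (Derive_n x 2 tau, 0, Derive_n z 2 tau)
      (opp (unit_normal eps (support_param x z) tau 0))
  / (Derive x tau ^ 2 + Derive z tau ^ 2).

(* The surface parametrized by X on Dom, with boundary parametrized by Bd, is a
   capillary surface with contact angle gamma on the surface S parametrized by Y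
   on DomY. D is the component of the complement of S that contains it, Om is
   the fluid, W the wetted region, N = unit_normal eps X and
   Ñ = unit_normal epsS Y. *)
Record is_capillary (X : R -> R -> R3) (Dom Bd : R -> R -> Prop)
    (Y : R -> R -> R3) (DomY : R -> R -> Prop) (D Om W : R3 -> Prop)
    (eps epsS gamma : R) : Prop := {
  cap_sign : is_sign eps /\ is_sign epsS;
  cap_interior : forall s t, Dom s t -> ~ Bd s t -> D (X s t);
  cap_boundary : forall s t, Bd s t ->
    exists a b, DomY a b /\ X s t = Y a b;
  cap_cmc : exists H, forall s t, Dom s t -> mean_curvature eps X s t = H;
  cap_fluid : is_domain Om /\ subset Om D;
  cap_wetted : is_region (fun p => exists a b, DomY a b /\ p = Y a b) W;
  cap_bounds : forall p,
    boundary Om p <-> (exists s t, Dom s t /\ p = X s t) \/ W p;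
  cap_N_inward : forall s t, Dom s t -> ~ Bd s t ->
    points_into Om (X s t) (unit_normal eps X s t);
  cap_NS_outward : forall a b, DomY a b -> W (Y a b) ->
    (forall s t, Dom s t -> X s t <> Y a b) ->
    points_into Om (Y a b) (opp (unit_normal epsS Y a b));
  cap_angle : forall s t a b, Bd s t -> DomY a b -> X s t = Y a b ->
    dot (unit_normal eps X s t) (unit_normal epsS Y a b) = cos gamma
}.

Definition cyl (r m s t : R) : R3 := (r * sin s, t, m + r * cos s).

Definition strip (s0 s t : R) : Prop := - s0 <= s <= s0.
Definition strip_boundary (s0 s t : R) : Prop := s = s0 \/ s = - s0.

Definition rect (s0 h s t : R) : Prop := - s0 <= s <= s0 /\ 0 <= t <= h.

(* Functions on the piece X([-s0,s0] x [0,h]) are written in the coordinates (s,t). *)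
Definition surface_integral (X : R -> R -> R3) (s0 h : R) (f : R -> R -> R) : R :=
  RInt (fun s => RInt (fun t => f s t * area_density X s t) 0 h) (- s0) s0.

Definition line_integral (X : R -> R -> R3) (h s : R) (f : R -> R) : R :=
  RInt (fun t => f t * sqrt (ffG X s t)) 0 h.

(* k is the curvature of the support curve at the contact points. *)
Definition bq (eps gamma k : R) (X : R -> R -> R3) (sg s t : R) : R :=
  k / sin gamma
  + cos gamma / sin gamma * sff eps X s t (conormal sg X s t) (conormal sg X s t).

Definition Q (eps gamma k : R) (X : R -> R -> R3) (s0 h : R) (u : R -> R -> R) : R :=
  surface_integral X s0 h
    (fun s t => grad_norm2 X u s t - sff_norm2 eps X s t * u s t ^ 2)
  - (line_integral X h s0 (fun t => bq eps gamma k X 1 s0 t * u s0 t ^ 2)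
     + line_integral X h (- s0)
         (fun t => bq eps gamma k X (-1) (- s0) t * u (- s0) t ^ 2)).

Definition unstable (eps gamma k : R) (X : R -> R -> R3) (s0 h : R) : Prop :=
  exists u : R -> R -> R,
    smooth2 u (rect s0 h) /\
    (forall s, - s0 <= s <= s0 -> u s 0 = 0 /\ u s h = 0) /\
    surface_integral X s0 h u = 0 /\
    Q eps gamma k X s0 h u < 0.

(* Main.v *)
(** Test functions [u(s,t) = phi(s) sin(2 pi t / h)] have mean zero on [Sigma_h].
    If [phi'' = c phi] and [phi' = +-p phi] at [s = +-s0], with [p = mu / sin gamma], an
    integration by parts turns [Q[u]] into
    [h / (2 r) * ((2 pi r / h)^2 - 1 - c) * int phi^2], which is negative as soon as
    [h > 2 pi r / sqrt (1 + c)]. The two cases are [phi = cosh (beta1 s)], [c = beta1^2] and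
    [phi = cos (beta11 s)], [c = -beta11^2]; the equation imposed on [beta] is the boundary
    condition. *)
Require Import Defs.
From Stdlib Require Import Reals Lra FunctionalExtensionality.
From Coquelicot Require Import Coquelicot.
Open Scope R_scope.

(** * Solutions of [f'' = c f] and smoothness of their products *)

(** Recording the derivative [f1] makes the class closed under differentiation: [(f1, c f)] is again
    such a pair. One predicate thus serves the profiles cosh and cos in [s] and the factor sin in
    [t]. *)
Definition second_order_solution (c : R) (f f1 : R -> R) : Prop :=
  forall x, is_derive f x (f1 x) /\ is_derive f1 x (c * f x).

Lemma second_order_solution_derive c f f1 :
  second_order_solution c f f1 ->
  second_order_solution c f1 (fun x => c * f x).
Proof.
  intros H x; split; [apply H|].
  apply (is_derive_scal f x c), H.
Qed.

Lemma second_order_solution_cosh b :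
  second_order_solution (b ^ 2) (fun s => cosh (b * s)) (fun s => b * sinh (b * s)).
Proof.
  intros x; unfold cosh, sinh; split; auto_derive; trivial; field.
Qed.

Lemma second_order_solution_cos b :
  second_order_solution (- b ^ 2) (fun s => cos (b * s)) (fun s => - b * sin (b * s)).
Proof.
  intros x; split; auto_derive; trivial; ring.
Qed.

Lemma second_order_solution_sin b :
  second_order_solution (- b ^ 2) (fun s => sin (b * s)) (fun s => b * cos (b * s)).
Proof.
  intros x; split; auto_derive; trivial; ring.
Qed.

Lemma second_order_solution_continuous c f f1 x :
  second_order_solution c f f1 -> continuous f x.
Proof.
  intros H; apply @ex_derive_continuous; exists (f1 x); apply H.
Qed.

Lemma continuity_2d_pt_product f g x y :
  continuous f x -> continuous g y ->
  continuity_2d_pt (fun a b => f a * g b) x y.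
Proof.
  intros Hf Hg; apply continuity_2d_pt_mult.
  - apply (continuity_1d_2d_pt_comp f (fun a _ => a)).
    + now apply continuity_pt_filterlim.
    + apply continuity_2d_pt_id1.
  - apply (continuity_1d_2d_pt_comp g (fun _ b => b)).
    + now apply continuity_pt_filterlim.
    + apply continuity_2d_pt_id2.
Qed.

(** Induction on the order, with the factors generalized: the partial derivatives of [f(a) g(b)] are
    [f1(a) g(b)] and [f(a) g1(b)], again products of solutions with the same constants. *)
Lemma ex_diff_n_product n : forall c d f f1 g g1 x y,
  second_order_solution c f f1 -> second_order_solution d g g1 ->
  ex_diff_n (fun a b => f a * g b) n x y.
Proof.
  induction n as [|n IH]; intros c d f f1 g g1 x y Hf Hg; simpl; split.
  1, 3: apply continuity_2d_pt_product; eapply second_order_solution_continuous; eassumption.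
  - trivial.
  - assert (D1 : forall a b, is_derive (fun a => f a * g b) a (f1 a * g b)).
    { intros a b; apply (is_derive_ext (fun a => g b * f a)); [intros; apply Rmult_comm|].
      rewrite Rmult_comm; apply (is_derive_scal f), Hf. }
    assert (D2 : forall a b, is_derive (fun b => f a * g b) b (f a * g1 b)).
    { intros a b; apply (is_derive_scal g), Hg. }
    repeat split.
    + eexists; apply D1.
    + eexists; apply D2.
    + replace (fun a b => Derive (fun z => f z * g b) a) with (fun a b => f1 a * g b).
      * eapply IH; [eapply second_order_solution_derive|]; eassumption.
      * extensionality a; extensionality b; symmetry; apply is_derive_unique, D1.
    + replace (fun a b => Derive (fun z => f a * g z) b) with (fun a b => f a * g1 b).
      * eapply IH; [|eapply second_order_solution_derive]; eassumption.
      * extensionality a; extensionality b; symmetry; apply is_derive_unique, D2.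
Qed.

Lemma smooth2_product c d f f1 g g1 P :
  second_order_solution c f f1 -> second_order_solution d g g1 ->
  smooth2 (fun a b => f a * g b) P.
Proof.
  intros Hf Hg s t _; apply locally_2d_forall; intros a b n.
  eapply ex_diff_n_product; eassumption.
Qed.

(** * Geometry of the circular cylinder *)

(** An equality of functions rather than of values, since the second fundamental form differentiates
    this field once more. *)
Lemma pd1_cyl r m :
  pd1 (cyl r m) = fun s _ => (r * cos s, 0, - (r * sin s)).
Proof.
  extensionality s; extensionality t; unfold pd1, cyl; simpl.
  f_equal; [f_equal|]; apply is_derive_unique; auto_derive; trivial; ring.
Qed.

Lemma pd2_cyl r m : pd2 (cyl r m) = fun _ _ => (0, 1, 0).
Proof.
  extensionality s; extensionality t; unfold pd2, cyl; simpl.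
  f_equal; [f_equal|]; apply is_derive_unique; auto_derive; trivial.
Qed.

Lemma ffE_cyl r m s t : ffE (cyl r m) s t = r ^ 2.
Proof.
  unfold ffE; rewrite pd1_cyl; simpl.
  generalize (sin2_cos2 s); unfold Rsqr; intros H.
  transitivity (r * r * (sin s * sin s + cos s * cos s)); [ring | rewrite H; ring].
Qed.

Lemma ffF_cyl r m s t : ffF (cyl r m) s t = 0.
Proof. unfold ffF; rewrite pd1_cyl, pd2_cyl; simpl; ring. Qed.

Lemma ffG_cyl r m s t : ffG (cyl r m) s t = 1.
Proof. unfold ffG; rewrite pd2_cyl; simpl; ring. Qed.

Lemma ffW_cyl r m s t : ffW (cyl r m) s t = r ^ 2.
Proof. unfold ffW; rewrite ffE_cyl, ffF_cyl, ffG_cyl; ring. Qed.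

Lemma area_density_cyl r m s t : 0 < r -> area_density (cyl r m) s t = r.
Proof.
  intros Hr; unfold area_density; rewrite ffW_cyl; apply sqrt_pow2; lra.
Qed.

(** The product [X_s x X_t] is radial of length [r] and points away from the axis, so [eps = -1] is
    the normal towards the axis. *)
Lemma unit_normal_cyl eps r m s t :
  0 < r -> unit_normal eps (cyl r m) s t = (eps * sin s, 0, eps * cos s).
Proof.
  intros Hr; unfold unit_normal; rewrite pd1_cyl, pd2_cyl.
  assert (Hn : vnorm (cross (r * cos s, 0, - (r * sin s)) (0, 1, 0)) = r).
  { unfold vnorm, dot, cross.
    transitivity (sqrt (r ^ 2)); [f_equal | apply sqrt_pow2; lra].
    generalize (sin2_cos2 s); unfold Rsqr; intros H.
    transitivity (r * r * (sin s * sin s + cos s * cos s)); [ring | rewrite H; ring]. }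
  cbv zeta; rewrite Hn; unfold cross.
  match goal with |- scal ?a (?u, ?v, ?w) = _ =>
    change (scal a (u, v, w)) with (a * u, a * v, a * w) end.
  f_equal; [f_equal|]; field; lra.
Qed.

Lemma sfL_cyl eps r m s t : 0 < r -> sfL eps (cyl r m) s t = - eps * r.
Proof.
  intros Hr; unfold sfL; rewrite unit_normal_cyl, pd1_cyl by assumption.
  unfold pd1; simpl.
  assert (H1 : Derive (fun a => r * cos a) s = - r * sin s)
    by (apply is_derive_unique; auto_derive; trivial; ring).
  assert (H2 : Derive (fun a => - (r * sin a)) s = - r * cos s)
    by (apply is_derive_unique; auto_derive; trivial; ring).
  rewrite H1, H2.
  generalize (sin2_cos2 s); unfold Rsqr; intros H.
  transitivity (- eps * r * (sin s * sin s + cos s * cos s)); [ring | rewrite H; ring].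
Qed.

Lemma sfM_cyl eps r m s t : sfM eps (cyl r m) s t = 0.
Proof.
  unfold sfM; rewrite pd1_cyl; unfold pd2; simpl; rewrite !Derive_const.
  destruct (unit_normal eps (cyl r m) s t) as [[a b] c]; simpl; ring.
Qed.

Lemma sfN_cyl eps r m s t : sfN eps (cyl r m) s t = 0.
Proof.
  unfold sfN; rewrite pd2_cyl; unfold pd2; simpl; rewrite !Derive_const.
  destruct (unit_normal eps (cyl r m) s t) as [[a b] c]; simpl; ring.
Qed.

(** The principal curvatures are [- eps / r] and 0; the sign disappears on squaring. *)
Lemma sff_norm2_cyl eps r m s t :
  0 < r -> is_sign eps -> sff_norm2 eps (cyl r m) s t = 1 / r ^ 2.
Proof.
  intros Hr Heps; unfold sff_norm2, mean_curvature, gauss_curvature.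
  rewrite sfL_cyl, sfM_cyl, sfN_cyl, ffE_cyl, ffF_cyl, ffG_cyl, ffW_cyl by assumption.
  destruct Heps as [-> | ->]; field; lra.
Qed.

(** * Integrals over a period in [t] and the energy of a profile in [s] *)

Lemma RInt_sin_period h c :
  0 < h -> RInt (fun t => c * sin (2 * PI / h * t)) 0 h = 0.
Proof.
  intros Hh.
  pose proof PI_RGT_0 as HPI.
  assert (Hw : 2 * PI / h <> 0) by (apply Rgt_not_eq, Rdiv_lt_0_compat; lra).
  apply is_RInt_unique.
  (* Only the value of the integral is rewritten, not its lower bound: the antiderivative takes
     equal values at both ends of a full period. *)
  replace 0 with (minus (- (c / (2 * PI / h)) * cos (2 * PI / h * h))
                        (- (c / (2 * PI / h)) * cos (2 * PI / h * 0))) at 2.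
  - apply (is_RInt_derive (fun t => - (c / (2 * PI / h)) * cos (2 * PI / h * t))).
    + intros t _; auto_derive; trivial; field; lra.
    + intros t _; apply (@ex_derive_continuous R_AbsRing R_NormedModule); auto_derive; trivial.
  - replace (2 * PI / h * h) with (2 * PI) by (field; lra).
    rewrite Rmult_0_r, cos_2PI, cos_0; unfold minus, plus, opp; simpl; ring.
Qed.

(** Both squares have mean 1/2 over a full period. The two coefficients receive the part of [Q]
    without [t]-derivatives and the part coming from [u_t]. *)
Lemma RInt_sin2_cos2_period h a b :
  0 < h ->
  RInt (fun t => a * sin (2 * PI / h * t) ^ 2 + b * cos (2 * PI / h * t) ^ 2) 0 h
  = (a + b) * (h / 2).
Proof.
  intros Hh.
  pose proof PI_RGT_0 as HPI.
  assert (Hw : 2 * PI / h <> 0) by (apply Rgt_not_eq, Rdiv_lt_0_compat; lra).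
  (* This antiderivative comes from the double-angle formulas; its periodic term vanishes at 0 and
     at [h]. *)
  set (F := fun t => (a + b) * t / 2
    + (b - a) * (sin (2 * PI / h * t) * cos (2 * PI / h * t)) / (2 * (2 * PI / h))).
  apply is_RInt_unique.
  replace ((a + b) * (h / 2)) with (minus (F h) (F 0)).
  - apply (is_RInt_derive F).
    + intros t _; unfold F; auto_derive; trivial.
      generalize (sin2_cos2 (2 * PI / h * t)); unfold Rsqr.
      set (w := 2 * PI / h) in *; intros H.
      replace ((a + b) * 1 * / 2) with
        ((a + b) * (sin (w * t) * sin (w * t) + cos (w * t) * cos (w * t)) * / 2)
        by (rewrite H; ring).
      field; assumption.
    + intros t _; apply (@ex_derive_continuous R_AbsRing R_NormedModule); auto_derive; trivial.
  - unfold F; replace (2 * PI / h * h) with (2 * PI) by (field; lra).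
    rewrite !Rmult_0_r, sin_2PI, sin_0; unfold minus, plus, opp; simpl; field; lra.
Qed.

(** By continuity the square stays positive on a short interval to the right of 0, and it is
    nonnegative elsewhere. Strictness here is what makes [Q] strictly negative later. *)
Lemma RInt_sqr_pos c f f1 s0 :
  0 < s0 -> second_order_solution c f f1 -> f 0 <> 0 ->
  0 < RInt (fun s => f s ^ 2) (- s0) s0.
Proof.
  intros Hs0 Hf Hf0.
  assert (Hc : forall s, continuous (fun s => f s ^ 2) s).
  { intros s; apply @ex_derive_continuous.
    apply ex_derive_pow; eexists; apply Hf. }
  assert (Hpos : 0 < f 0 ^ 2) by nra.
  assert (Hi : forall a b, ex_RInt (fun s => f s ^ 2) a b)
    by (intros; apply @ex_RInt_continuous; intros; apply Hc).
  destruct (Hc 0 (fun y => 0 < y)) as [e He].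
  { now apply open_gt. }
  (* Half the radius keeps [[0, e1]] inside the ball where the square is positive; the bound [s0]
     keeps it inside the domain. *)
  set (e1 := Rmin (e / 2) s0).
  assert (He1 : 0 < e1 /\ e1 < e /\ e1 <= s0).
  { destruct e as [e e_pos]; unfold e1; simpl in *.
    generalize (Rmin_l (e / 2) s0) (Rmin_r (e / 2) s0); intros.
    repeat split; try lra. apply Rmin_glb_lt; lra. }
  assert (Hge : forall a b, a <= b -> 0 <= RInt (fun s => f s ^ 2) a b).
  { intros a b Hab; apply RInt_ge_0; auto; intros; apply pow2_ge_0. }
  rewrite <- (RInt_Chasles _ (- s0) 0 s0), <- (RInt_Chasles _ 0 e1 s0) by auto.
  assert (0 < RInt (fun s => f s ^ 2) 0 e1).
  { apply RInt_gt_0; [lra| |intros; apply Hc].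
    intros s Hs; apply He; unfold ball; simpl; unfold AbsRing_ball, abs, minus, plus, opp; simpl.
    rewrite Rabs_pos_eq; lra. }
  assert (0 <= RInt (fun s => f s ^ 2) (- s0) 0) by (apply Hge; lra).
  assert (0 <= RInt (fun s => f s ^ 2) e1 s0) by (apply Hge; lra).
  apply Rplus_le_lt_0_compat; [assumption|]; now apply Rplus_lt_le_0_compat.
Qed.

(** Integration by parts: [(f f1)' = f1^2 + c f^2], and the boundary conditions turn the increment
    of [f f1] into [p] times the sum of the end squares. The remainder is [(k - c) f^2]. *)
Lemma RInt_energy c f f1 s0 p k :
  0 < s0 -> second_order_solution c f f1 ->
  f1 s0 = p * f s0 -> f1 (- s0) = - p * f (- s0) ->
  RInt (fun s => f1 s ^ 2 + k * f s ^ 2) (- s0) s0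
  = p * (f s0 ^ 2 + f (- s0) ^ 2) + (k - c) * RInt (fun s => f s ^ 2) (- s0) s0.
Proof.
  intros Hs0 Hf Hp Hm.
  assert (Df : forall s, ex_derive f s) by (intros; eexists; apply Hf).
  assert (Df1 : forall s, ex_derive f1 s) by (intros; eexists; apply Hf).
  apply is_RInt_unique.
  apply (is_RInt_ext (fun s => plus (f1 s ^ 2 + c * f s ^ 2) (scal (k - c) (f s ^ 2)))).
  { intros s _; unfold plus, scal; simpl; unfold mult; simpl; ring. }
  apply @is_RInt_plus.
  - replace (p * (f s0 ^ 2 + f (- s0) ^ 2))
      with (minus (f s0 * f1 s0) (f (- s0) * f1 (- s0))).
    2: { rewrite Hp, Hm; unfold minus, plus, opp; simpl; ring. }
    apply (is_RInt_derive (fun s => f s * f1 s)).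
    + intros s _; auto_derive; [repeat split; auto|].
      replace (Derive (fun x => f x) s) with (f1 s) by (symmetry; apply is_derive_unique, Hf).
      replace (Derive (fun x => f1 x) s) with (c * f s)
        by (symmetry; apply is_derive_unique, Hf).
      ring.
    + intros s _; apply (@ex_derive_continuous R_AbsRing R_NormedModule).
      auto_derive; repeat split; auto.
  - apply @is_RInt_scal, (@RInt_correct R_CompleteNormedModule), @ex_RInt_continuous; intros s _.
    apply @ex_derive_continuous; auto_derive; auto.
Qed.

(** * Instability from a separated mode *)

(** The length condition is squared so that one statement covers both signs of [c]. The boundary
    coefficient is [p / r] with the same [p] as in the boundary conditions, so the line integrals
    cancel the boundary terms of [RInt_energy]. *)
Lemma unstable_of_mode eps gamma k r m s0 h c p f f1 :
  0 < r -> 0 < s0 -> 0 < h -> is_sign eps ->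
  (forall sg t, is_sign sg -> bq eps gamma k (cyl r m) sg (sg * s0) t = p / r) ->
  second_order_solution c f f1 -> f 0 <> 0 ->
  f1 s0 = p * f s0 -> f1 (- s0) = - p * f (- s0) ->
  (2 * PI * r) ^ 2 < (1 + c) * h ^ 2 ->
  unstable eps gamma k (cyl r m) s0 h.
Proof.
  intros Hr Hs0 Hh Heps Hq Hf Hf0 Hp Hm Hlen.
  set (w := 2 * PI / h).
  exists (fun s t => f s * sin (w * t)).
  split; [|split; [|split]].
  - eapply (smooth2_product _ _ f f1 (fun t => sin (w * t))); eauto.
    apply second_order_solution_sin.
  - intros s _; replace (w * h) with (2 * PI) by (unfold w; field; lra).
    rewrite Rmult_0_r, sin_0, sin_2PI; lra.
  - unfold surface_integral.
    rewrite (RInt_ext _ (fun _ => 0)), RInt_const; [apply Rmult_0_r|].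
    intros s _; transitivity (RInt (fun t => r * f s * sin (2 * PI / h * t)) 0 h);
      [|now apply RInt_sin_period].
    apply RInt_ext; intros t _; rewrite area_density_cyl by assumption; simpl; fold w; ring.
  - unfold Q, surface_integral.
    rewrite (RInt_ext _ (fun s => scal (h / (2 * r)) (f1 s ^ 2 + ((r * w) ^ 2 - 1) * f s ^ 2))).
    2: {
      intros s _.
      (* For fixed [s], the coefficient of [sin^2] is [(f1^2 - f^2) / r] and that of [cos^2] is
         [r w^2 f^2]; each is multiplied by [h / 2]. *)
      apply (@eq_trans R _ (((f1 s ^ 2 - f s ^ 2) / r + r * w ^ 2 * f s ^ 2) * (h / 2))).
      2: unfold scal; simpl; unfold mult; simpl; field; lra.
      rewrite <- RInt_sin2_cos2_period by assumption; fold w.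
      apply RInt_ext; intros t _.
      rewrite area_density_cyl, sff_norm2_cyl by assumption.
      unfold grad_norm2; rewrite ffE_cyl, ffF_cyl, ffG_cyl, ffW_cyl.
      assert (H1 : Derive (fun a => f a * sin (w * t)) s = f1 s * sin (w * t)).
      { rewrite Derive_scal_l; f_equal; apply is_derive_unique, Hf. }
      assert (H2 : Derive (fun b => f s * sin (w * b)) t = f s * (w * cos (w * t))).
      { apply is_derive_unique; auto_derive; trivial; ring. }
      rewrite H1, H2; simpl; field; lra. }
    rewrite (RInt_scal (fun s => f1 s ^ 2 + ((r * w) ^ 2 - 1) * f s ^ 2)).
    2: { apply @ex_RInt_continuous; intros s _; apply @ex_derive_continuous.
         auto_derive; repeat split; eexists; apply Hf. }
    rewrite (RInt_energy c f f1 s0 p) by assumption.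
    assert (HL : forall sg, is_sign sg ->
      line_integral (cyl r m) h (sg * s0)
        (fun t => bq eps gamma k (cyl r m) sg (sg * s0) t * (f (sg * s0) * sin (w * t)) ^ 2)
      = p / r * f (sg * s0) ^ 2 * (h / 2)).
    { intros sg Hsg; unfold line_integral.
      (* The zero is the coefficient of [cos^2], so that the period formula applies. *)
      transitivity ((p / r * f (sg * s0) ^ 2 + 0) * (h / 2)); [|ring].
      rewrite <- RInt_sin2_cos2_period by assumption; fold w.
      apply RInt_ext; intros t _; rewrite ffG_cyl, sqrt_1, Hq by assumption; simpl; ring. }
    pose proof (HL 1 (or_introl eq_refl)) as HL1.
    pose proof (HL (-1) (or_intror eq_refl)) as HL2.
    rewrite !Rmult_1_l in HL1.
    replace (-1 * s0) with (- s0) in HL2 by ring.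
    rewrite HL1, HL2.
    assert (HJ := RInt_sqr_pos c f f1 s0 Hs0 Hf Hf0).
    set (J := RInt (fun s => f s ^ 2) (- s0) s0) in *.
    unfold scal; simpl; unfold mult; simpl.
    assert (Hk : (r * w) ^ 2 - 1 - c < 0).
    { assert ((r * w) ^ 2 * h ^ 2 = (2 * PI * r) ^ 2) by (unfold w; field; lra).
      assert (0 < h ^ 2) by nra. nra. }
    (* All terms containing [p] have cancelled. *)
    match goal with |- ?e < 0 =>
      replace e with (h / (2 * r) * (((r * w) ^ 2 - 1 - c) * J)) by (field; lra) end.
    assert (0 < h / (2 * r)) by (apply Rdiv_lt_0_compat; lra).
    assert (((r * w) ^ 2 - 1 - c) * J < 0) by nra.
    nra.
Qed.

(** * The threshold length and the equations for the two parameters *)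

(** Removes the square root from the threshold, and also yields [0 < h], which follows from
    exceeding a positive bound. *)
Lemma critical_length a k h :
  0 < a -> 0 < k -> a / sqrt k < h -> 0 < h /\ a ^ 2 < k * h ^ 2.
Proof.
  intros Ha Hk Hh.
  assert (Hs : 0 < sqrt k) by now apply sqrt_lt_R0.
  assert (Hs2 : sqrt k * sqrt k = k) by (apply sqrt_sqrt; lra).
  assert (H0 : 0 < a / sqrt k) by now apply Rdiv_lt_0_compat.
  assert (a < h * sqrt k) by (apply Rlt_div_l in Hh; lra).
  split; [lra|].
  rewrite <- Hs2; nra.
Qed.

Lemma ex_derive_continuity f : (forall x, ex_derive f x) -> continuity f.
Proof.
  intros Hf x; apply continuity_pt_filterlim, @ex_derive_continuous, Hf.
Qed.

(** Both sides are squares of positive numbers because [p < b]; extracting the roots and clearing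
    the denominator leaves an equation that makes sense at [b = p] too. *)
Lemma beta1_iff p s b :
  0 < p -> 0 < s -> p < b ->
  (exp (4 * b * s) = ((b + p) / (b - p)) ^ 2 <-> exp (2 * b * s) * (b - p) = b + p).
Proof.
  intros Hp Hs Hb.
  assert (He := exp_pos (2 * b * s)).
  assert (Hd : 0 < (b + p) / (b - p)) by (apply Rdiv_lt_0_compat; lra).
  replace (exp (4 * b * s)) with (exp (2 * b * s) ^ 2).
  2: { simpl; rewrite Rmult_1_r, <- exp_plus; f_equal; ring. }
  split; intros H.
  - replace (exp (2 * b * s)) with ((b + p) / (b - p)) by nra. field; lra.
  - f_equal; rewrite <- H; field; lra.
Qed.

(** Existence is by the intermediate value theorem for the cleared equation. Uniqueness holds
    because [exp (2 b s)] increases in [b] while [(b + p) / (b - p)] decreases. *)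
Lemma beta1_exists_unique p s :
  0 < p -> 0 < s ->
  exists! b, p < b /\ exp (4 * b * s) = ((b + p) / (b - p)) ^ 2.
Proof.
  intros Hp Hs.
  assert (Hinv : 0 < / s) by now apply Rinv_0_lt_compat.
  (* At [p] the function equals [-2 p]. At [p + 1/s] the bound [1 + x < exp x] with [x = 2 p s + 2]
     gives a value above [2 / s]. *)
  destruct (IVT (fun b => exp (2 * b * s) * (b - p) - (b + p)) p (p + / s)) as [b [Hb1 Hb2]].
  - apply ex_derive_continuity; intros b; auto_derive; trivial.
  - lra.
  - nra.
  - assert (1 + 2 * (p + / s) * s < exp (2 * (p + / s) * s)).
    { apply exp_ineq1; apply Rgt_not_eq; nra. }
    replace (2 * (p + / s) * s) with (2 * p * s + 2) in * by (field; lra).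
    replace (p + / s - p) with (/ s) by ring.
    assert (/ s * s = 1) by (field; lra).
    assert ((3 + 2 * p * s) * / s < exp (2 * p * s + 2) * / s)
      by (apply Rmult_lt_compat_r; lra).
    replace ((3 + 2 * p * s) * / s) with (3 * / s + 2 * p) in * by (field; lra).
    lra.
  - assert (Hbp : p < b).
    { destruct (Req_dec b p) as [-> | Hn]; [|lra].
      replace (p - p) with 0 in Hb2 by ring; lra. }
    exists b; split.
    + split; [assumption|]; apply beta1_iff; lra.
    + intros b' [Hb' H']; apply beta1_iff in H'; try assumption.
      assert (H : exp (2 * b * s) * (b - p) = b + p) by lra.
      assert (Hlt : forall b b', p < b -> b < b' ->
        exp (2 * b * s) * (b - p) = b + p -> exp (2 * b' * s) * (b' - p) = b' + p -> False).
      { clear - Hp Hs; intros b b' Hb Hbb H H'.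
        assert (He : exp (2 * b * s) < exp (2 * b' * s)) by (apply exp_increasing; nra).
        (* Monotonicity with denominators cleared: by the two equations this positive product equals
           [2 p (b - b')], which is negative. *)
        assert (0 < (exp (2 * b' * s) - exp (2 * b * s)) * ((b - p) * (b' - p)))
          by (repeat apply Rmult_lt_0_compat; lra).
        replace ((exp (2 * b' * s) - exp (2 * b * s)) * ((b - p) * (b' - p))) with
          (exp (2 * b' * s) * (b' - p) * (b - p) - exp (2 * b * s) * (b - p) * (b' - p))
          in * by ring.
        rewrite H, H' in *; nra. }
      destruct (Rtotal_order b b') as [Hbb | [Hbb | Hbb]]; [exfalso | assumption | exfalso].
      * apply (Hlt b b'); assumption.
      * apply (Hlt b' b); assumption.
Qed.

(** Dividing by [exp (b s)] gives [b (e^{bs} - e^{-bs}) = p (e^{bs} + e^{-bs})]. *)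
Lemma cosh_boundary_condition p s b :
  exp (2 * b * s) * (b - p) = b + p -> b * sinh (b * s) = p * cosh (b * s).
Proof.
  intros H.
  assert (He := exp_pos (b * s)).
  replace (2 * b * s) with (b * s + b * s) in H by ring.
  rewrite exp_plus in H.
  unfold cosh, sinh; rewrite exp_Ropp.
  apply (Rmult_eq_reg_l (2 * exp (b * s))); [|lra].
  field_simplify; [nra | lra | lra].
Qed.

(** The cosine is positive on the stated range, so it can be cleared. The range of [b * s] is
    returned as well, for the monotonicity of [tan]. *)
Lemma beta11_iff q s b :
  0 < s -> 0 < b < PI / (2 * s) ->
  (tan (b * s) = q / b <-> b * sin (b * s) = q * cos (b * s)) /\ 0 < b * s < PI / 2.
Proof.
  intros Hs [Hb1 Hb2].
  assert (Hbs : 0 < b * s < PI / 2).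
  { split; [nra|]; apply (Rmult_lt_compat_r s) in Hb2; [|assumption].
    replace (PI / (2 * s) * s) with (PI / 2) in Hb2 by (field; lra); assumption. }
  split; [|assumption].
  assert (Hc : 0 < cos (b * s)) by (apply cos_gt_0; lra).
  unfold tan; split; intros H.
  - replace (sin (b * s)) with (sin (b * s) / cos (b * s) * cos (b * s)) by (field; lra).
    rewrite H; field; lra.
  - apply (Rmult_eq_reg_l (b * cos (b * s))); [|nra].
    field_simplify; lra.
Qed.

(** The cleared equation stays continuous at [PI / (2 s)], where [tan] blows up, so the intermediate
    value theorem applies on the closed interval. Uniqueness: [tan (b s)] increases in [b] and
    [q / b] decreases. *)
Lemma beta11_exists_unique q s :
  0 < q -> 0 < s ->
  exists! b, 0 < b < PI / (2 * s) /\ tan (b * s) = q / b.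
Proof.
  intros Hq Hs.
  pose proof PI_RGT_0 as HPI.
  assert (Hmax : 0 < PI / (2 * s)) by (apply Rdiv_lt_0_compat; lra).
  assert (Hmaxs : PI / (2 * s) * s = PI / 2) by (field; lra).
  destruct (IVT (fun b => b * sin (b * s) - q * cos (b * s)) 0 (PI / (2 * s)))
    as [b [Hb1 Hb2]].
  - apply ex_derive_continuity; intros b; auto_derive; trivial.
  - assumption.
  - rewrite !Rmult_0_l, cos_0; lra.
  - rewrite Hmaxs, sin_PI2, cos_PI2; lra.
  - assert (Hb : 0 < b < PI / (2 * s)).
    { split.
      - destruct (Req_dec b 0) as [-> | Hn]; [|lra].
        rewrite !Rmult_0_l, cos_0 in Hb2; lra.
      - destruct (Req_dec b (PI / (2 * s))) as [-> | Hn]; [|lra].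
        rewrite Hmaxs, sin_PI2, cos_PI2 in Hb2; lra. }
    assert (H : tan (b * s) = q / b) by (apply beta11_iff; lra).
    exists b; split; [now split|].
    intros b' [Hb' H'].
    assert (Hlt : forall b b', 0 < b < PI / (2 * s) -> 0 < b' < PI / (2 * s) -> b < b' ->
      tan (b * s) = q / b -> tan (b' * s) = q / b' -> False).
    { clear - Hq Hs; intros b b' Hb Hb' Hbb H H'.
      destruct (beta11_iff q s b Hs Hb) as [_ Hi].
      destruct (beta11_iff q s b' Hs Hb') as [_ Hi'].
      assert (tan (b * s) < tan (b' * s)) by (apply tan_increasing; nra).
      assert (q / b' < q / b).
      { apply Rmult_lt_compat_l; [assumption|]; apply Rinv_lt_contravar; nra. }
      lra. }
    destruct (Rtotal_order b b') as [Hbb | [Hbb | Hbb]]; [exfalso | assumption | exfalso].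
    * apply (Hlt b b'); assumption.
    * apply (Hlt b' b); assumption.
Qed.

(** * The two cases, according to the sign of [mu] *)

Theorem corollary4p2
  (I : R -> Prop) (x z : R -> R)
  (HI : is_interval I)
  (Hsmooth : smooth1 x I /\ smooth1 z I)
  (Hreg : regular_curve x z I)
  (Hemb : embedded_curve x z I)
  (Hsym : symmetric_curve x z I)
  (D D' : R3 -> Prop)
  (Hsep : separates (support x z I) D D')
  (r m s0 gamma : R)
  (Hr : 0 < r) (Hs0 : 0 < s0 < PI) (Hgamma : 0 < gamma < PI)
  (Om W : R3 -> Prop) (eps epsS : R)
  (Hcap : is_capillary (cyl r m) (strip s0) (strip_boundary s0)
            (support_param x z) (fun tau _ => I tau) D Om W eps epsS gamma)
  (Hmeet : forall s t, strip s0 s t ->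
     (support x z I (cyl r m s t) <-> strip_boundary s0 s t))
  (tau0 : R) (Htau0 : I tau0)
  (Hcontact : cyl r m s0 0 = curve x z tau0 /\
              cyl r m (- s0) 0 = curve x z (- tau0))
  (delta : R) (Hdelta : is_sign delta)
  (HA : forall sg t, is_sign sg ->
     sff eps (cyl r m) (sg * s0) t
       (conormal sg (cyl r m) (sg * s0) t)
       (conormal sg (cyl r m) (sg * s0) t) = delta / r)
  (mu : R) (Hmu : mu = r * kappa epsS x z tau0 + delta * cos gamma)
  (Hne : sin gamma - s0 * mu <> 0) (Hmu0 : mu <> 0) :
  (0 < mu ->
     let is_beta1 beta :=
       mu / sin gamma < beta /\
       exp (4 * beta * s0)
         = ((beta * sin gamma + mu) / (beta * sin gamma - mu)) ^ 2 in
     (exists! beta1, is_beta1 beta1) /\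
     forall beta1, is_beta1 beta1 ->
     forall h, 2 * PI * r / sqrt (1 + beta1 ^ 2) < h ->
       unstable eps gamma (kappa epsS x z tau0) (cyl r m) s0 h)
  /\
  (mu < 0 ->
     let is_beta11 beta :=
       0 < beta < PI / (2 * s0) /\
       tan (beta * s0) = - (mu / (beta * sin gamma)) in
     (exists! beta11, is_beta11 beta11) /\
     forall beta11, is_beta11 beta11 -> beta11 < 1 ->
     forall h, 2 * PI * r / sqrt (1 - beta11 ^ 2) < h ->
       unstable eps gamma (kappa epsS x z tau0) (cyl r m) s0 h).
Proof.
  destruct (cap_sign _ _ _ _ _ _ _ _ _ _ _ Hcap) as [Heps _].
  assert (Hsg : 0 < sin gamma) by (apply sin_gt_0; lra).
  set (k := kappa epsS x z tau0) in *.
  (* With [A(nu,nu) = delta / r], the coefficient in the boundary term is the constant [p / r],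
     where [p = mu / sin gamma]. *)
  assert (Hbq : forall sg t, is_sign sg ->
    bq eps gamma k (cyl r m) sg (sg * s0) t = mu / sin gamma / r).
  { intros sg t Hs; unfold bq; rewrite HA by assumption; rewrite Hmu; field; lra. }
  split; intros Hsign; cbv zeta.
  - assert (Hp : 0 < mu / sin gamma) by now apply Rdiv_lt_0_compat.
    assert (Heq : forall beta, mu / sin gamma < beta ->
      (beta * sin gamma + mu) / (beta * sin gamma - mu)
      = (beta + mu / sin gamma) / (beta - mu / sin gamma)).
    { intros beta Hb.
      assert (mu < beta * sin gamma) by (apply Rlt_div_l in Hb; lra).
      field; repeat split; lra. }
    split.
    + destruct (beta1_exists_unique (mu / sin gamma) s0) as [b [[Hb1 Hb2] Hb3]]; try lra.
      exists b; split.
      * split; [assumption|]; rewrite Heq; assumption.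
      * intros b' [Hb1' Hb2']; apply Hb3; split; [assumption|]; rewrite <- Heq; assumption.
    + intros b [Hb1 Hb2] h Hh.
      rewrite Heq, beta1_iff in Hb2 by lra.
      apply cosh_boundary_condition in Hb2.
      apply critical_length in Hh; [|pose proof PI_RGT_0; nra | nra].
      eapply (unstable_of_mode eps gamma k r m s0 h (b ^ 2) (mu / sin gamma)
                (fun s => cosh (b * s)) (fun s => b * sinh (b * s)));
        try easy; [apply second_order_solution_cosh | | ].
      * rewrite Rmult_0_r, cosh_0; lra.
      (* The condition at [- s0] follows from the one at [s0] by parity: cosh is even and sinh is
         odd. *)
      * replace (b * - s0) with (- (b * s0)) by ring.
        assert (Hch : cosh (- (b * s0)) = cosh (b * s0))
          by (unfold cosh; rewrite Ropp_involutive; field).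
        assert (Hsh : sinh (- (b * s0)) = - sinh (b * s0))
          by (unfold sinh; rewrite Ropp_involutive; field).
        rewrite Hch, Hsh; lra.
  (* Here the positive parameter of the tangent equation is [q = - p]. *)
  - assert (Hq : 0 < - mu / sin gamma) by (apply Rdiv_lt_0_compat; lra).
    assert (Heq : forall beta, 0 < beta ->
      - (mu / (beta * sin gamma)) = - mu / sin gamma / beta) by (intros; field; lra).
    split.
    + destruct (beta11_exists_unique (- mu / sin gamma) s0) as [b [[Hb1 Hb2] Hb3]]; try lra.
      exists b; split.
      * split; [assumption|]; rewrite Heq; lra.
      * intros b' [Hb1' Hb2']; apply Hb3; split; [assumption|]; rewrite <- Heq; lra.
    + intros b [Hb1 Hb2] Hb h Hh.
      rewrite Heq in Hb2 by lra.
      apply beta11_iff in Hb2; try lra.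
      (* The assumption [b < 1] makes [1 - b^2] positive. *)
      apply critical_length in Hh; [|pose proof PI_RGT_0; nra | nra].
      eapply (unstable_of_mode eps gamma k r m s0 h (- b ^ 2) (mu / sin gamma)
                (fun s => cos (b * s)) (fun s => - b * sin (b * s)));
        try easy; [apply second_order_solution_cos | | | ].
      * rewrite Rmult_0_r, cos_0; lra.
      * transitivity (- (b * sin (b * s0))); [ring|]; rewrite Hb2; field; lra.
      * replace (b * - s0) with (- (b * s0)) by ring; rewrite sin_neg, cos_neg.
        transitivity (b * sin (b * s0)); [ring|]; rewrite Hb2; field; lra.
Qed.
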